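(* Let $G$ be a finite simple non-trivial graph with $m$ edges such that no connected component of $G$ is isomorphic to a path graph $P_n$ with $n\le 6$ vertices. Then $$GA_1(\mathcal{L}(G))\ge 2\sqrt{m-1}.$$
   Context: A graph is non-trivial if each of its connected components has at least two edges. $P_n$ is the path graph with $n$ vertices. For a finite simple graph $H$, with $d_u$ the degree of the vertex $u$ in $H$, the first geometric-arithmetic index is $GA_1(H)=\sum_{uv\in E(H)}\frac{2\sqrt{d_u d_v}}{d_u+d_v}$ (each edge counted once). The line graph $\mathcal{L}(G)$ has the edges of $G$ as vertices, two distinct ones being adjacent if and only if they share an endpoint in $G$. *)

(* Defs.v *)
From HB Require Import structures.
From mathcomp Require Import all_boot all_order all_algebra.

Set Implicit Arguments.
Unset Strict Implicit.
Unset Printing Implicit Defensive.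

Import Order.TTheory GRing.Theory Num.Theory.
Local Open Scope ring_scope.

(* A finite simple graph is a symmetric irreflexive relation on a finType;
   the definitions below take an arbitrary relation. *)
Definition simple_graph (T : finType) (e : rel T) : Prop :=
  symmetric e /\ irreflexive e.

Definition edges (T : finType) (e : rel T) : {set {set T}} :=
  [set [set x; y] | x in T, y in T & e x y].

Definition degree (T : finType) (e : rel T) (u : T) : nat :=
  #|[set v | e u v]|.

(* For an edge A = {u, v} with u != v, the product and the sum over A are
   d_u d_v and d_u + d_v. *)
Definition GA1 (R : rcfType) (T : finType) (e : rel T) : R :=
  \sum_(A in edges e)
    2 * Num.sqrt (\prod_(u in A) (degree e u)%:R)
      / \sum_(u in A) (degree e u)%:R.

Definition line_graph (T : finType) (e : rel T) :
    rel {A : {set T} | A \in edges e} :=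
  fun A B => (A != B) && (val A :&: val B != set0).
Arguments line_graph [T] e A B.

Definition induced (T : finType) (e : rel T) (C : {set T}) :
    rel {x : T | x \in C} :=
  fun x y => e (val x) (val y).
Arguments induced [T] e C x y.

Definition component (T : finType) (e : rel T) (x : T) : {set T} :=
  [set y | connect e x y].

Definition path_graph (n : nat) : rel 'I_n :=
  fun i j => (i.+1 == j :> nat) || (j.+1 == i :> nat).
Arguments path_graph n i j : clear implicits.

Definition graph_iso (T1 T2 : finType) (e1 : rel T1) (e2 : rel T2) : Prop :=
  exists2 f : T1 -> T2, bijective f & forall x y, e2 (f x) (f y) = e1 x y.

Definition nontrivial_graph (T : finType) (e : rel T) : Prop :=
  forall x : T, (2 <= #|edges (induced e (component e x))|)%N.

(* Main.v *)
(* Let C be a component of the line graph, with c vertices and a arcs (ordered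
   adjacent pairs).
   If a >= 2c, the degrees on C lie in [1, c - 1], so each edge has weight at
   least 2 sqrt(c - 1) / c; there are at least c edges, so C contributes at
   least 2 sqrt(c - 1).
   If a < 2c, then a = 2c - 2 since C is connected, and C has no triangle (an
   edge of a triangle could be deleted keeping C connected).  Three neighbours
   of a vertex of a line graph always contain two adjacent ones, so the degrees
   on C are at most 2, and likewise in the component of G below C, which is then
   a path; it has at least 7 vertices by hypothesis, so c >= 6.  At most two
   edges of C have weight less than 1, and these at least 3/4, which leaves
   at least c - 3/2 >= 2 sqrt(c - 1).
   The bounds add up because sqrt(a - 1) + sqrt(b - 1) >= sqrt(a + b - 1) for
   a, b >= 2. *)
Require Import Defs.
From HB Require Import structures.
From mathcomp Require Import all_boot all_order all_algebra.
From mathcomp Require Import zify ring lra.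
Import Order.TTheory GRing.Theory Num.Theory.
Local Open Scope ring_scope.

Set Implicit Arguments.
Unset Strict Implicit.
Unset Printing Implicit Defensive.

(** * Counting arcs in a connected component *)

Definition arcs (T : finType) (e : rel T) (C : {set T}) : {set T * T} :=
  [set p | (p.1 \in C) && e p.1 p.2].

Lemma card_arcs (T : finType) (e : rel T) (C : {set T}) :
  #|arcs e C| = (\sum_(x in C) degree e x)%N.
Proof.
rewrite -sum1_card (eq_bigl (fun p => (p.1 \in C) && e p.1 p.2)); last first.
  by move=> p; rewrite inE.
rewrite -(pair_big_dep (mem C) (fun x y => e x y) (fun _ _ => 1%N)) /=.
by apply: eq_bigr => x _; rewrite sum1_card /degree cardsE.
Qed.

Lemma component_refl (T : finType) (e : rel T) (x : T) : x \in component e x.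
Proof. by rewrite inE connect0. Qed.

Lemma component_step (T : finType) (e : rel T) (x y z : T) :
  y \in component e x -> e y z -> z \in component e x.
Proof. by rewrite !inE => cxy eyz; apply: connect_trans cxy (connect1 eyz). Qed.

Lemma component_sub (T : finType) (e : rel T) (x : T) (D : {set T}) :
  x \in D -> (forall y z, y \in D -> e y z -> z \in D) -> component e x \subset D.
Proof.
move=> xD clD; apply/subsetP => y; rewrite inE => /connectP[p ep ->].
elim: p x xD ep => //= z p IHp x xD /andP[exz ep].
exact: IHp (clD _ _ xD exz) ep.
Qed.

(** A connected graph on c vertices has at least c - 1 edges. Among the subsets of the component
    that contain [x] and satisfy the bound for their inner arcs, one of largest size is closed under
    [e], hence is everything. *)
Lemma card_component_le (T : finType) (e : rel T) (x : T) :
  symmetric e -> irreflexive e ->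
  (2 * #|component e x| <= #|arcs e (component e x)| + 2)%N.
Proof.
move=> e_sym e_irr; set C := component e x.
pose inner (D : {set T}) := [set p in arcs e D | p.2 \in D].
pose P (D : {set T}) := [&& D \subset C, x \in D & (2 * #|D| <= #|inner D| + 2)%N].
have Px : P [set x].
  by rewrite /P sub1set component_refl inE eqxx cards1 /=; lia.
case: (arg_maxnP (fun D : {set T} => #|D|) Px) => D /and3P[sDC xD leD] maxD.
suff CD : C \subset D.
  have -> : C = D by apply/eqP; rewrite eqEsubset CD.
  apply: leq_trans leD _; rewrite leq_add2r subset_leq_card //.
  by apply/subsetP => p; rewrite inE => /andP[].
apply: component_sub => // y z yD eyz; apply/negPn/negP => zD.
suff : P (z |: D) by move/maxD; rewrite /= cardsU1 zD; lia.
apply/and3P; split.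
- rewrite subUset sub1set sDC andbT.
  by apply: component_step eyz; apply: (subsetP sDC).
- by rewrite !inE xD orbT.
(* Adding [z] raises the left side by 2 and the right side by at least 2: the arcs between [y] and
   [z] are new because [z] lies outside [D]. *)
have sub : [set (y, z); (z, y)] :|: inner D \subset inner (z |: D).
  apply/subsetP => -[a b]; rewrite !inE /= => /orP[/orP[]/eqP[-> ->]|].
  - by rewrite yD eyz eqxx !orbT.
  - by rewrite yD e_sym eyz eqxx !orbT.
  - by case/andP=> /andP[-> ->] ->; rewrite !orbT.
have yz : y != z by apply: contraNneq zD => <-.
have dis : [set (y, z); (z, y)] :&: inner D = set0.
  apply/setP => -[a b]; rewrite !inE /=; apply/negP => /andP[] /orP[]/eqP[-> ->];
  by rewrite (negPf zD) ?andbF.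
have := subset_leq_card sub; rewrite cardsU dis cards0 cards2 cardsU1 zD.
rewrite xpair_eqE (negPf yz) /=; rewrite subn0 => le.
rewrite mulnDr muln1 addnC leq_add2r.
by apply: leq_trans leD _; rewrite addnC.
Qed.

(** Deleting the edge between [x] and [y] keeps the component, thanks to the detour through [z]. The
    bound of [card_component_le] for the remaining graph is then improved by the two deleted
    arcs. *)
Lemma card_component_triangle (T : finType) (e : rel T) (r x y z : T) :
  symmetric e -> irreflexive e -> x \in component e r ->
  e x y -> e y z -> e z x ->
  (2 * #|component e r| <= #|arcs e (component e r)|)%N.
Proof.
move=> e_sym e_irr xC exy eyz ezx.
pose e' : rel T := fun a b =>
  e a b && ~~ (((a == x) && (b == y)) || ((a == y) && (b == x))).
have e'_sym : symmetric e'.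
  by move=> a b; rewrite /e' e_sym; congr (_ && ~~ _); rewrite orbC; congr orb; rewrite andbC.
have e'_irr : irreflexive e' by move=> a; rewrite /e' e_irr.
have neq a b : e a b -> a != b by apply: contraTneq => ->; rewrite e_irr.
have e'yz : e' y z.
  by rewrite /e' eyz [z == x](negPf (neq _ _ ezx)) eq_sym (negPf (neq _ _ exy)) andbF.
have e'zx : e' z x.
  rewrite /e' ezx (negPf (neq _ _ ezx)) /= eq_sym.
  by rewrite [y == z](negPf (neq _ _ eyz)).
have cyx : connect e' y x := connect_trans (connect1 e'yz) (connect1 e'zx).
have cxy : connect e' x y by rewrite (sym_connect_sym e'_sym).
have compE : component e' r = component e r.
  apply/setP => a; rewrite !inE; apply/idP/idP; apply: connect_sub => {}a b.
    by case/andP => eab _; apply: connect1.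
  move=> eab; case e'ab: (e' a b); first exact: connect1.
  move: e'ab; rewrite /e' eab /= => /negbFE/orP[]/andP[/eqP-> /eqP->] //.
have := @card_component_le _ _ r e'_sym e'_irr; rewrite compE.
set C := component e r in xC *.
have sub : [set (x, y); (y, x)] :|: arcs e' C \subset arcs e C.
  apply/subsetP => -[a b]; rewrite !inE /= => /orP[/orP[]/eqP[-> ->]|].
  - by rewrite exy inE in xC *; rewrite xC.
  - by rewrite e_sym exy andbT; have := component_step xC exy; rewrite inE.
  - by case/andP=> -> /andP[->].
have dis : [set (x, y); (y, x)] :&: arcs e' C = set0.
  apply/setP => -[a b]; rewrite !inE /=; apply/negP => /andP[] /orP[]/eqP[-> ->];
  by rewrite /e' !eqxx ?orbT /= !andbF.
have := subset_leq_card sub; rewrite cardsU dis cards0 cards2.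
rewrite xpair_eqE (negPf (neq _ _ exy)) /= subn0 addnC => le le2; exact: leq_trans le2 le.
Qed.

(** * Recognising a path by its degrees *)

(** Only the last vertex is ever extended, so [x] stays the first vertex; this suffices because [x]
    will have degree at most 1. *)
Lemma maximal_path (T : finType) (e : rel T) (x : T) (s : seq T) :
  path e x s -> uniq (x :: s) ->
  exists s', [/\ path e x s', uniq (x :: s')
    & forall y, e (last x s') y -> y \in x :: s'].
Proof.
have [k] := ubnP (#|T| - size s); elim: k s => // k IHk s ltk ps us.
have [/existsP[y /andP[ey ys]]|/existsPn ns] :=
  boolP [exists y, e (last x s) y && (y \notin x :: s)]; last first.
  exists s; split=> // y ey; have := ns y; by rewrite ey negbK.
have us' : uniq (x :: rcons s y) by rewrite -rcons_cons rcons_uniq ys.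
apply: (IHk (rcons s y)) => //; last by rewrite rcons_path ps.
have : (size (x :: rcons s y) <= #|T|)%N by rewrite -(card_uniqP us') max_card.
rewrite /= size_rcons; move: ltk; move: #|T| => N; lia.
Qed.

Lemma degree_gt1 (T : finType) (e : rel T) (x y z : T) :
  e x y -> e x z -> y != z -> (1 < degree e x)%N.
Proof. by move=> exy exz yz; apply/card_gt1P; exists y, z; rewrite !inE. Qed.

Lemma degree_gt2 (T : finType) (e : rel T) (x a b c : T) :
  e x a -> e x b -> e x c -> a != b -> b != c -> c != a -> (2 < degree e x)%N.
Proof.
by move=> ea eb ec ab bc ca; apply/card_gt2P; exists a, b, c; rewrite !inE.
Qed.

(** A maximal path starting at [x] swallows the whole component: the degree bounds leave no room for
    a chord or an edge off the path. The isomorphism sends a vertex to its position. *)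
Lemma path_iso (T : finType) (e : rel T) (x : T) :
  symmetric e -> irreflexive e -> (degree e x <= 1)%N ->
  (forall y, y \in component e x -> (degree e y <= 2)%N) ->
  graph_iso (induced e (component e x)) (path_graph #|component e x|).
Proof.
move=> e_sym e_irr dx d2.
have [s [ps us maxs]] := @maximal_path _ e x [::] isT isT.
set t := x :: s in us maxs.
have nth_inj i j : (i < size t)%N -> (j < size t)%N -> nth x t i = nth x t j -> i = j.
  by move=> lti ltj /eqP; rewrite nth_uniq // => /eqP.
have et i : (i.+1 < size t)%N -> e (nth x t i) (nth x t i.+1).
  by move=> lti; have /pathP := ps; apply.
have sub y : y \in t -> y \in component e x.
  by move=> yt; rewrite inE; apply: path_connect ps _ yt.
have inner i y : (i.+2 < size t)%N -> e (nth x t i.+1) y ->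
    y = nth x t i \/ y = nth x t i.+2.
  move=> lti ey; have [->|y1] := eqVneq y (nth x t i); first by left.
  have [->|y2] := eqVneq y (nth x t i.+2); first by right.
  have := d2 (nth x t i.+1); rewrite leqNgt sub; last exact: mem_nth (ltnW lti).
  move=> /(_ isT)/negP[].
  apply: (@degree_gt2 _ _ _ (nth x t i) (nth x t i.+2) y) => //.
  - by rewrite e_sym et // ltnW.
  - exact: et.
  - by apply/eqP => /nth_inj E; have := E (ltnW (ltnW lti)) lti; move=> {}E; clear -E; lia.
  - by rewrite eq_sym.
have start y : e x y -> (1 < size t)%N /\ y = nth x t 1.
  move=> exy; have lt1 : (1 < size t)%N.
    rewrite ltnNge; apply/negP => le1.
    have s0 : s = [::] by apply/size0nil; move: le1; rewrite /t /=; lia.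
    have := maxs y; rewrite /t s0 /= => /(_ exy); rewrite inE => /eqP yx.
    by rewrite yx e_irr in exy.
  split=> //; apply/eqP/negPn/negP => ny.
  by move: dx; rewrite leqNgt (degree_gt1 exy (et 0%N lt1) ny).
have nbr i y : (i < size t)%N -> e (nth x t i) y ->
    exists2 j, y = nth x t j & (j < size t)%N && ((i.+1 == j) || (j.+1 == i)).
  case: i => [|i] lti ey.
    by have [lt1 ->] := start y ey; exists 1%N; rewrite ?lt1.
  have [lti2|lei] := ltnP i.+2 (size t).
    by case: (inner i y lti2 ey) => ->; [exists i|exists i.+2]; rewrite ?eqxx ?orbT ?lti2 ?(ltnW lti).
  (* At the last vertex, maximality puts [y] on the path. Its neighbours are known from its own,
     earlier position, and the last vertex is one of them, so [y] is the predecessor. *)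
  have iE : i.+1 = size s by move: lti lei; rewrite /t /=; lia.
  have tiE : nth x t i.+1 = last x s by rewrite iE (last_nth x).
  have yt : y \in t by apply: maxs; rewrite -tiE.
  have ltj : (index y t < size t)%N by rewrite index_mem.
  have yE : nth x t (index y t) = y by rewrite nth_index.
  rewrite -yE e_sym in ey *; exists (index y t) => //; rewrite ltj andTb.
  case: (index y t) ltj ey => [|j] ltj ey.
    by have [lt1 /nth_inj E] := start _ ey; rewrite E.
  have ij : j != i by apply: contraTneq ey => ->; rewrite e_irr.
  have ltj2 : (j.+2 < size t)%N by move: lti ltj lei ij; lia.
  by case: (inner j _ ltj2 ey) => /nth_inj; lia.
have compE : component e x =i t.
  move=> y; apply/idP/idP; last exact: sub.
  move=> yC; suff /subsetP/(_ y yC) : component e x \subset [set z in t] by rewrite in_set.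
  apply: component_sub; first by rewrite inE mem_head.
  move=> a b; rewrite !in_set => at_ eab.
  have := nbr (index a t) b; rewrite index_mem nth_index // => /(_ at_ eab).
  by case=> j -> /andP[ltj _]; apply: mem_nth.
have cardE : #|component e x| = size t by rewrite (eq_card compE) (card_uniqP us).
have ltC (u : {y | y \in component e x}) : (index (val u) t < #|component e x|)%N.
  by rewrite cardE index_mem -compE (valP u).
exists (fun u => Ordinal (ltC u)).
  apply: inj_card_bij; last by rewrite card_ord card_sig.
  move=> u v /(congr1 (@nat_of_ord _)) E; apply: val_inj.
  have : nth x t (index (val u) t) = nth x t (index (val v) t) by congr nth; exact: E.
  by rewrite !nth_index -?compE ?(valP u) ?(valP v).
move=> u v.
change (((index (val u) t).+1 == index (val v) t)
  || ((index (val v) t).+1 == index (val u) t) = e (val u) (val v)).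
have ut : val u \in t by rewrite -compE (valP u).
have vt : val v \in t by rewrite -compE (valP v).
rewrite -{3}(nth_index x ut) -{3}(nth_index x vt).
have := ut; have := vt; rewrite -!index_mem.
move: (index _ t) (index _ t) => j i ltj lti.
apply/idP/idP.
  by case/orP=> /eqP E; [rewrite -E in ltj *|rewrite -E e_sym in lti *]; apply: et.
case/(nbr _ _ lti) => k E /andP[ltk].
by rewrite (nth_inj _ _ ltj ltk E).
Qed.

(** * Edges and the structure of line graphs *)

Lemma edgesP (T : finType) (e : rel T) (A : {set T}) :
  reflect (exists x y, e x y /\ A = [set x; y]) (A \in edges e).
Proof.
apply: (iffP imset2P) => [[x y _]|[x [y [exy ->]]]].
  by rewrite inE => /andP[_ exy] ->; exists x, y.
by exists x y; rewrite ?inE.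
Qed.

Lemma edges_pair (T : finType) (e : rel T) (x y : T) :
  e x y -> [set x; y] \in edges e.
Proof. by move=> exy; apply/edgesP; exists x, y. Qed.

Definition edge_vertex (T : finType) (e : rel T) (x y : T) (exy : e x y) :
    {A : {set T} | A \in edges e} :=
  exist (fun A : {set T} => A \in edges e) [set x; y] (edges_pair exy).

Lemma line_graph_sym (T : finType) (e : rel T) : symmetric (line_graph e).
Proof. by move=> A B; rewrite /line_graph eq_sym setIC. Qed.

Lemma line_graph_irr (T : finType) (e : rel T) : irreflexive (line_graph e).
Proof. by move=> A; rewrite /line_graph eqxx. Qed.

Lemma line_graph_meet (T : finType) (e : rel T) (x : T)
    (A B : {A : {set T} | A \in edges e}) :
  x \in val A -> x \in val B -> A != B -> line_graph e A B.
Proof.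
by move=> xA xB AB; rewrite /line_graph AB; apply/set0Pn; exists x; rewrite inE xA.
Qed.

(** Consecutive edges of a walk share a vertex, and edges with a common vertex are equal or
    adjacent. *)
Lemma connect_line_graph (T : finType) (e : rel T) (x y : T)
    (A B : {A : {set T} | A \in edges e}) :
  connect e x y -> x \in val A -> y \in val B -> connect (line_graph e) A B.
Proof.
have meet z (A' B' : {A : {set T} | A \in edges e}) :
    z \in val A' -> z \in val B' -> connect (line_graph e) A' B'.
  have [->|AB] := eqVneq A' B'; first by rewrite connect0.
  by move=> zA zB; apply: connect1; apply: line_graph_meet zA zB AB.
case/connectP => p ep ->; elim: p x A ep => /= [|z p IHp] x A; first by move=> _; apply: meet.
case/andP=> exz ep xA yB; pose E := edge_vertex exz.
apply: connect_trans (meet x A E xA _) (IHp z E ep _ yB); by rewrite !inE eqxx ?orbT.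
Qed.

(** Every neighbour of [A] contains one of the two ends of [A], so two of three neighbours meet in
    the same end. *)
Lemma line_graph_clawfree (T : finType) (e : rel T)
    (A : {A : {set T} | A \in edges e}) :
  (2 < degree (line_graph e) A)%N ->
  exists B C, [/\ line_graph e A B, line_graph e B C & line_graph e C A].
Proof.
have [u [v [euv AE]]] := edgesP _ _ (valP A).
have uv B : line_graph e A B -> (u \in val B) || (v \in val B).
  case/andP=> _ /set0Pn[w]; rewrite AE !inE => /andP[/orP[]/eqP-> ->] //.
  by rewrite orbT.
case/card_gt2P => [B [C [D [[]]]]]; rewrite !inE => AB AC AD [BC CD DB].
have tri X Y w : line_graph e A X -> line_graph e A Y -> X != Y ->
    w \in val X -> w \in val Y ->
    exists B C, [/\ line_graph e A B, line_graph e B C & line_graph e C A].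
  move=> AX AY XY wX wY; exists X, Y; split=> //; last by rewrite line_graph_sym.
  exact: line_graph_meet wX wY XY.
case/orP: (uv _ AB) => wB; case/orP: (uv _ AC) => wC; case/orP: (uv _ AD) => wD;
  by [exact: tri AB AC BC wB wC | exact: tri AC AD CD wC wD | exact: tri AD AB DB wD wB].
Qed.

Lemma eq_pair_r (T : finType) (x y z : T) :
  x != y -> [set x; y] = [set x; z] -> y = z.
Proof.
move=> xy /setP/(_ y); rewrite !inE eqxx orbT [y == x]eq_sym (negPf xy) /=.
by move/esym/eqP.
Qed.

(** Three edges at [x] meet there pairwise. In the absence of triangles this bounds the degrees in
    the underlying graph. *)
Lemma line_graph_triangle (T : finType) (e : rel T) (x : T) :
  irreflexive e -> (2 < degree e x)%N ->
  exists A B C : {A : {set T} | A \in edges e}, [/\ x \in val A, line_graph e A B, line_graph e B C & line_graph e C A].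
Proof.
move=> e_irr; case/card_gt2P => [a [b [c [[]]]]]; rewrite !inE => xa xb xc [ab bc ca].
pose E y (exy : e x y) := edge_vertex exy.
have adj y z (exy : e x y) (exz : e x z) : y != z -> line_graph e (E y exy) (E z exz).
  move=> yz; apply: (@line_graph_meet _ _ x); rewrite ?inE ?eqxx //.
  apply: contra_neq yz => /(congr1 val) /=; apply: eq_pair_r.
  by apply: contraTneq exy => <-; rewrite e_irr.
exists (E a xa), (E b xb), (E c xc); split; rewrite ?adj //.
by rewrite !inE eqxx.
Qed.

(** Otherwise each end of [A] carries a further edge, and these are two distinct neighbours of
    [A]. *)
Lemma line_graph_leaf (T : finType) (e : rel T)
    (A : {A : {set T} | A \in edges e}) :
  symmetric e -> irreflexive e -> (degree (line_graph e) A <= 1)%N ->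
  exists2 x, x \in val A & (degree e x <= 1)%N.
Proof.
move=> e_sym e_irr dA; have [u [v [euv AE]]] := edgesP _ _ (valP A).
have neq a b : e a b -> a != b by apply: contraTneq => ->; rewrite e_irr.
have [du|du] := leqP (degree e u) 1; first by exists u; rewrite // AE !inE eqxx.
have [dv|dv] := leqP (degree e v) 1; first by exists v; rewrite // AE !inE eqxx orbT.
have other a b : (1 < degree e a)%N -> exists2 c, e a c & c != b.
  case/card_gt1P => c [d]; rewrite !inE => -[ac ad cd].
  have [cb|] := eqVneq c b; last by exists c.
  by exists d; rewrite // -cb eq_sym.
have [u' uu' u'v] := other u v du; have [v' vv' v'u] := other v u dv.
pose E x y (exy : e x y) := edge_vertex exy.
move: dA; rewrite leqNgt => /negP[].
apply: (@degree_gt1 _ _ _ (E u u' uu') (E v v' vv')).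
- apply: (@line_graph_meet _ _ u); rewrite ?AE ?inE ?eqxx //.
  apply: contra_neq u'v => /(congr1 val); rewrite AE /= => /eq_pair_r -> //.
  exact: neq.
- apply: (@line_graph_meet _ _ v); rewrite ?AE ?inE ?eqxx ?orbT //.
  apply: contra_neq v'u => /(congr1 val); rewrite AE /= setUC => /eq_pair_r -> //.
  by rewrite eq_sym neq.
(* The vertex [u] separates the two edges, even if [u'] and [v'] coincide. *)
- apply/eqP => /(congr1 val)/setP/(_ u); rewrite /= !inE eqxx.
  by rewrite [u == v'](eq_sym) (negPf v'u) (negPf (neq _ _ euv)).
Qed.

(** Double counting: each arc in the component of [x] gives the incidence of its source with its
    edge, and the edges in [C] have [2 * #|C|] incidences. The claim follows with
    [card_component_le]. *)
Lemma card_component_line_graph (T : finType) (e : rel T) (x : T)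
    (A : {A : {set T} | A \in edges e}) :
  symmetric e -> irreflexive e -> x \in val A ->
  (#|component e x| <= #|component (line_graph e) A|.+1)%N.
Proof.
move=> e_sym e_irr xA; set C := component (line_graph e) A.
have neq a b : e a b -> a != b by apply: contraTneq => ->; rewrite e_irr.
(* [F] forgets the proof of being an edge, so that its values can be compared with those of [G]. *)
pose F (p : T * {A : {set T} | A \in edges e}) := (p.1, val p.2).
pose inc := [set p : T * {A : {set T} | A \in edges e} | (p.2 \in C) && (p.1 \in val p.2)].
pose G (p : T * T) := (p.1, [set p.1; p.2]).
have cinc : #|inc| = (2 * #|C|)%N.
  rewrite -sum1_card (eq_bigl (fun p => (p.2 \in C) && (p.1 \in val p.2))); last first.
    by move=> p; rewrite inE.
  rewrite (reindex_onto (fun q => (q.2, q.1)) (fun q => (q.2, q.1))) /=; last by case.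
  rewrite (eq_bigl (fun p => (p.1 \in C) && (p.2 \in val p.1))); last first.
    by case=> B y /=; rewrite eqxx andbT.
  rewrite -(pair_big_dep (mem C) (fun B y => y \in val B) (fun _ _ => 1%N)) /=.
  rewrite (eq_bigr (fun=> 2%N)); first by rewrite sum_nat_const mulnC.
  move=> B _; have [u [v [euv ->]]] := edgesP _ _ (valP B).
  by rewrite sum1_card cards2 neq.
have sub : G @: arcs e (component e x) \subset F @: inc.
  apply/subsetP => q /imsetP[[a b]]; rewrite inE /= => /andP[xa ab] ->.
  apply/imsetP; exists (a, edge_vertex ab); rewrite // !inE /= eqxx andbT.
  by rewrite inE in xa; apply: connect_line_graph xa xA _; rewrite !inE eqxx.
have injG : {in arcs e (component e x) &, injective G}.
  move=> [a b] [c d]; rewrite !inE /= => /andP[_ ab] /andP[_ cd] [ac abcd].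
  subst c; rewrite (eq_pair_r (neq _ _ ab) abcd) //.
have := leq_trans (subset_leq_card sub) (leq_imset_card _ _).
rewrite card_in_imset // cinc => le1.
have := leq_trans (card_component_le x e_sym e_irr) (leq_add le1 (leqnn 2)).
by move: (#|component e x|) (#|C|) => p q; lia.
Qed.

Lemma line_graph_component (T : finType) (e : rel T)
    (A : {A : {set T} | A \in edges e}) :
  symmetric e -> irreflexive e ->
  (forall (x : T) (n : nat), (n <= 6)%N ->
     ~ graph_iso (induced e (component e x)) (path_graph n)) ->
  let C := component (line_graph e) A in
  (#|arcs (line_graph e) C| < 2 * #|C|)%N ->
  (forall B, B \in C -> (degree (line_graph e) B <= 2)%N) /\ (6 <= #|C|)%N.
Proof.
move=> e_sym e_irr Hpath C lt.
have notri X Y Z : X \in C -> line_graph e X Y -> line_graph e Y Z ->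
    line_graph e Z X -> False.
  move=> XC XY YZ ZX; move: lt; rewrite ltnNge => /negP[].
  exact: card_component_triangle (@line_graph_sym _ e) (@line_graph_irr _ e) XC XY YZ ZX.
split.
  move=> B BC; rewrite leqNgt; apply/negP => /line_graph_clawfree[X [Y [BX XY YB]]].
  exact: notri BC BX XY YB.
(* If all degrees on [C] were at least 2, there would be at least [2 * #|C|] arcs. *)
have [B /andP[BC dB]|no] :=
  pickP [pred B | (B \in C) && (degree (line_graph e) B <= 1)%N]; last first.
  have d2 B : B \in C -> (1 < degree (line_graph e) B)%N.
    by move=> BC; have := no B; rewrite /= BC ltnNge => /negbT.
  move: lt; rewrite ltnNge card_arcs => /negP[].
  by rewrite mulnC -sum_nat_const leq_sum.
have [x xB dx] := line_graph_leaf e_sym e_irr dB.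
have CE : component (line_graph e) B = C.
  apply/setP => D; rewrite inE in BC *; rewrite inE.
by rewrite [D \in C]inE (same_connect (sym_connect_sym (@line_graph_sym _ e)) BC).
have := card_component_line_graph e_sym e_irr xB; rewrite CE => le.
(* If [C] had at most 5 elements, the component of [x] would have at most 6 vertices, and [Hpath]
   forbids it to be a path. *)
rewrite leqNgt; apply/negP => lt6; apply: (Hpath x _ (leq_trans le lt6)).
apply: path_iso => // y yx; rewrite leqNgt; apply/negP.
case/(line_graph_triangle e_irr) => X [Y [Z [yX XY YZ ZX]]].
apply: notri XY YZ ZX; rewrite -CE inE; apply: connect_line_graph xB yX.
by rewrite inE in yx.
Qed.

(** * Lower bounds for the weight of an edge *)

Definition gm_am (R : rcfType) (a b : R) : R := 2 * Num.sqrt (a * b) / (a + b).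


(** The extreme case is the pair 1, [k]. After squaring and clearing denominators the difference is
    (k a - b)(k b - a), whose factors are nonnegative since k a >= k >= b and k b >= k >= a. *)
Lemma gm_am_ge (R : rcfType) (k a b : R) :
  1 <= a <= k -> 1 <= b <= k -> 2 * Num.sqrt k / (k + 1) <= gm_am a b.
Proof.
move=> /andP[a1 ak] /andP[b1 bk].
rewrite /gm_am ler_pdivrMr; last lra.
rewrite mulrAC ler_pdivlMr; last lra.
rewrite -!mulrA ler_pM2l; last lra.
have k0 : 0 <= k by lra.
have ab0 : 0 <= a * b by apply: mulr_ge0; lra.
rewrite -(@ler_pXn2r _ 2) ?nnegrE //; last 2 first.
- by apply: mulr_ge0; rewrite ?sqrtr_ge0 //; lra.
- by apply: mulr_ge0; rewrite ?sqrtr_ge0 //; lra.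
rewrite !exprMn !sqr_sqrtr // -subr_ge0.
have -> : a * b * (k + 1) ^+ 2 - k * (a + b) ^+ 2 = (k * a - b) * (k * b - a) by ring.
by apply: mulr_ge0; nra.
Qed.

(** Each end of degree 1 costs 1/4: the bounds are 1, 3/4 and 1/2, against the weights 1, 2 sqrt(2)
    / 3 and 1. Being additive in the two ends, the loss can be summed vertex by vertex. *)
Lemma gm_am_ge_deg2 (R : rcfType) (a b : nat) :
  (0 < a <= 2)%N -> (0 < b <= 2)%N ->
  1 - (2 - a%:R) / 4 - (2 - b%:R) / 4 <= gm_am a%:R b%:R :> R.
Proof.
have key (x y : R) : 0 < x -> 0 < y -> x <= 2 -> y <= 2 ->
    (1 - (2 - x) / 4 - (2 - y) / 4) ^+ 2 * (x + y) ^+ 2 <= 4 * (x * y) ->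
    1 - (2 - x) / 4 - (2 - y) / 4 <= gm_am x y.
  move=> x0 y0 x2 y2 le; rewrite /gm_am ler_pdivlMr; last lra.
  have xy0 : 0 <= x * y by apply: mulr_ge0; lra.
  rewrite -(@ler_pXn2r _ 2) ?nnegrE //; last 2 first.
  - by apply: mulr_ge0; lra.
  - by apply: mulr_ge0; rewrite ?sqrtr_ge0 //; lra.
  rewrite !exprMn sqr_sqrtr //; lra.
case: a => [|[|[|a]]] //; case: b => [|[|[|b]]] // _ _; apply: key; lra.
Qed.

(** * The contribution of one component *)

(** Each edge underlies exactly two arcs, whence the factor 1/2. Arcs, unlike edges, can be grouped
    by their source, hence by component. *)
Lemma GA1_arcs (R : rcfType) (T : finType) (e : rel T) :
  symmetric e -> irreflexive e ->
  GA1 R e = 2^-1 * \sum_x \sum_(y | e x y) gm_am (degree e x)%:R (degree e y)%:R.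
Proof.
move=> e_sym e_irr; rewrite /GA1 pair_big_dep /=.
rewrite (partition_big (fun p : T * T => [set p.1; p.2]) (mem (edges e))) /=; last first.
  by case=> x y /= exy; apply/imset2P; exists x y; rewrite ?inE.
rewrite mulr_sumr; apply: eq_bigr => A /imset2P[x y _].
rewrite inE => /andP[_ exy] ->.
have xy : x != y by apply: contraTneq exy => ->; rewrite e_irr.
rewrite (bigD1 (x, y)) /=; last by rewrite exy eqxx.
rewrite (bigD1 (y, x)) /=; last first.
  by rewrite e_sym exy (setUC [set y]) eqxx xpair_eqE [y == x]eq_sym (negPf xy).
(* No third arc has the same pair of ends. *)
rewrite [X in _ = _ * (_ + (_ + X))]big_pred0; last first.
  move=> z; case: z => a b /=; apply/negP => /andP[/andP[/andP[eab /eqP abE]]]; rewrite !xpair_eqE.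
  have ab : a != b by apply: contraTneq eab => ->; rewrite e_irr.
  have : x \in [set a; b] by rewrite abE !inE eqxx.
  have : y \in [set a; b] by rewrite abE !inE eqxx orbT.
  rewrite !inE => /orP[]/eqP yE /orP[]/eqP xE; move: xy;
  by rewrite yE xE ?eqxx ?andbF //= eq_sym (negPf ab) /= ?eqxx.
rewrite addr0 /gm_am !big_setU1 ?inE //= !big_set1.
rewrite [X in _ = _ * (_ + 2 * Num.sqrt X / _)]mulrC [(degree e y)%:R + _]addrC.
lra.
Qed.

Lemma degree_component (T : finType) (e : rel T) (r x : T) :
  irreflexive e -> x \in component e r -> (degree e x < #|component e r|)%N.
Proof.
move=> e_irr xC; apply: proper_card; apply/properP; split.
  by apply/subsetP => y; rewrite inE; apply: component_step.
by exists x; rewrite // inE e_irr.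
Qed.

Lemma degree_gt0 (T : finType) (e : rel T) (x y : T) : e x y -> (0 < degree e x)%N.
Proof. by move=> exy; apply/card_gt0P; exists y; rewrite inE. Qed.

Lemma GA1_component_dense (R : rcfType) (T : finType) (e : rel T) (r : T) :
  symmetric e -> irreflexive e -> let C := component e r in
  (2 * #|C| <= #|arcs e C|)%N ->
  2 * Num.sqrt (#|C|%:R - 1) <=
    2^-1 * \sum_(x in C) \sum_(y | e x y) gm_am (degree e x)%:R (degree e y)%:R :> R.
Proof.
move=> e_sym e_irr C dense; set k : R := #|C|%:R - 1.
have C0 : (0 < #|C|)%N by apply/card_gt0P; exists r; apply: component_refl.
have k0 : 0 <= k by rewrite subr_ge0 ler1n.
have bnd x y : x \in C -> e x y -> 1 <= ((degree e x)%:R : R) <= k.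
  move=> xC exy; rewrite ler1n (degree_gt0 exy) /k lerBrDr natr1 ler_nat.
  exact: degree_component.
have le : #|arcs e C|%:R * (2 * Num.sqrt k / (k + 1)) <=
    \sum_(x in C) \sum_(y | e x y) gm_am (degree e x)%:R (degree e y)%:R :> R.
  rewrite card_arcs natr_sum mulr_suml; apply: ler_sum => x xC.
  rewrite mulr_natl; have {1}-> : degree e x = #|e x| by rewrite /degree cardsE.
  rewrite -sumr_const; apply: ler_sum => y exy.
  apply: gm_am_ge; first exact: (bnd x y).
  by apply: (bnd y x); rewrite 1?e_sym //; apply: component_step exy.
have w0 : 0 <= 2 * Num.sqrt k / (k + 1).
  by rewrite divr_ge0 ?mulr_ge0 ?sqrtr_ge0 //; lra.
have : (2 * #|C|)%:R * (2 * Num.sqrt k / (k + 1)) <= #|arcs e C|%:R * (2 * Num.sqrt k / (k + 1)).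
  by rewrite ler_wpM2r // ler_nat.
move/le_trans/(_ le); rewrite natrM.
(* With [k + 1] vertices and at least [2 * (k + 1)] arcs, the denominator of the weight bound
   cancels. *)
have -> : #|C|%:R = k + 1 :> R by rewrite /k subrK.
have -> : 2 * (k + 1) * (2 * Num.sqrt k / (k + 1)) = 2 * (2 * Num.sqrt k).
  by field; lra.
lra.
Qed.

(** Write c for the vertices and a for the arcs of [C]. Charging the loss [f] at both ends of every
    arc leaves at least a - (2c - a)/2, which is at least 2c - 3 as a >= 2c - 2; half of it is c -
    3/2. *)
Lemma GA1_component_sparse (R : rcfType) (T : finType) (e : rel T) (r : T) :
  symmetric e -> irreflexive e -> let C := component e r in
  (forall x, x \in C -> (degree e x <= 2)%N) -> (6 <= #|C|)%N ->
  2 * Num.sqrt (#|C|%:R - 1) <=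
    2^-1 * \sum_(x in C) \sum_(y | e x y) gm_am (degree e x)%:R (degree e y)%:R :> R.
Proof.
move=> e_sym e_irr C d2 C6.
pose f x : R := (2 - (degree e x)%:R) / 4.
pose c : R := #|C|%:R; pose a : R := #|arcs e C|%:R.
have step x y : x \in C -> e x y -> y \in C by apply: component_step.
have sumf : \sum_(x in C) \sum_(y | e x y) f x <= (2 * c - a) / 4.
  have -> : (2 * c - a) / 4 = \sum_(x in C) f x.
    rewrite -mulr_suml sumrB sumr_const -natr_sum -card_arcs; congr (_ / _).
    by rewrite /a /c mulr_natr.
  (* The charge [f x] occurs once per arc out of [x]: once for degree 1, while it vanishes for
     degree 2. *)
  apply: ler_sum => x xC; rewrite sumr_const.
  have -> : #|e x| = degree e x by rewrite /degree cardsE.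
  rewrite /f; move: (d2 x xC); case: (degree e x) => [|[|[|d]]] // _; rewrite ?mulr0n ?mulr1n ?mulr2n; lra.
have sumf' : \sum_(x in C) \sum_(y | e x y) f y = \sum_(x in C) \sum_(y | e x y) f x.
  rewrite (exchange_big_dep (mem C)) /=; last by move=> x y; apply: step.
  apply: eq_bigr => y yC; apply: eq_bigl => x; rewrite e_sym.
  by case eyx: (e y x); rewrite ?andbF // andbT (step y x).
have le : a - 2 * ((2 * c - a) / 4) <=
    \sum_(x in C) \sum_(y | e x y) gm_am (degree e x)%:R (degree e y)%:R :> R.
  apply: (@le_trans _ _ (\sum_(x in C) \sum_(y | e x y) (1 - f x - f y))).
    have -> : \sum_(x in C) \sum_(y | e x y) (1 - f x - f y) =
        a - \sum_(x in C) \sum_(y | e x y) f x - \sum_(x in C) \sum_(y | e x y) f y.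
      under eq_bigr do rewrite !sumrB; rewrite !sumrB; congr (_ - _ - _).
      rewrite /a card_arcs natr_sum; apply: eq_bigr => x _.
      by rewrite sumr_const /degree cardsE.
    rewrite sumf'; lra.
  apply: ler_sum => x xC; apply: ler_sum => y exy; apply: gm_am_ge_deg2.
    by rewrite d2 // (degree_gt0 exy).
  by rewrite d2 ?(step x y) // (@degree_gt0 _ e y x) // e_sym.
have ca : 2 * c <= a + 2.
  by rewrite /a /c -natrM -natrD ler_nat card_component_le.
have c6 : 6 <= c by rewrite /c ler_nat.
(* Squared, this is c^2 - 7c + 25/4 >= 0, which holds at c = 6 with 1/4 to spare and fails at c =
   5. *)
suff : Num.sqrt (c - 1) <= (c - 3 / 2) / 2 by rewrite -/c; lra.
rewrite -[X in _ <= X]ger0_norm ?ler_wsqrtr //; last lra.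
rewrite -sqrtr_sqr ler_wsqrtr //; nra.
Qed.

(** * Summing over the components *)

Lemma sqrt_sum_le (R : rcfType) (I : finType) (P : pred I) (c : I -> nat) (F : I -> R) :
  (forall i, P i -> (2 <= c i)%N) ->
  (forall i, P i -> 2 * Num.sqrt ((c i)%:R - 1) <= F i) ->
  2 * Num.sqrt ((\sum_(i | P i) c i)%:R - 1) <= \sum_(i | P i) F i.
Proof.
move=> c2 le.
pose K (n : nat) (y : R) := ((n == 0%N) || (2 <= n)%N) /\ 2 * Num.sqrt (n%:R - 1) <= y /\ 0 <= y.
suff [] : K (\sum_(i | P i) c i)%N (\sum_(i | P i) F i) by move=> _ [].
have s0 : Num.sqrt (0%:R - 1 : R) = 0 by apply: ler0_sqrtr; lra.
apply: (big_ind2 K).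
- by split=> //; rewrite s0 mulr0.
- move=> n1 y1 n2 y2 [n10 [le1 y10]] [n20 [le2 y20]].
  split; first by move: n10 n20; lia.
  split; last lra.
  have [n1E|n1P] := eqVneq n1 0%N; first by rewrite n1E add0n; lra.
  have [n2E|n2P] := eqVneq n2 0%N; first by rewrite n2E addn0; lra.
  rewrite (negPf n1P) (negPf n2P) /= in n10 n20.
  have h1 : 2 <= n1%:R :> R by rewrite ler_nat.
  have h2 : 2 <= n2%:R :> R by rewrite ler_nat.
  suff : Num.sqrt ((n1 + n2)%:R - 1 : R) <= Num.sqrt (n1%:R - 1) + Num.sqrt (n2%:R - 1) by lra.
  (* Squaring reduces the claim to 2 s t >= 1, and both roots are at least 1. *)
  set s := Num.sqrt (n1%:R - 1); set t := Num.sqrt (n2%:R - 1).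
  have t1 : 1 <= t by rewrite -[X in X <= _]sqrtr1 ler_wsqrtr //; lra.
  have s1 : 1 <= s by rewrite -[X in X <= _]sqrtr1 ler_wsqrtr //; lra.
  rewrite -[X in _ <= X]ger0_norm; last lra.
  rewrite -sqrtr_sqr ler_wsqrtr // sqrrD !sqr_sqrtr ?natrD; [|lra|lra].
  nra.
- move=> i Pi; split; first by rewrite c2 ?orbT.
  split; first exact: le.
  by apply: le_trans (le i Pi); rewrite mulr_ge0 ?sqrtr_ge0.
Qed.

(** The graph is arbitrary here; in the application its vertices are the edges of the original
    graph. Components are indexed by their [fingraph.root]. *)
Lemma GA1_ge (R : rcfType) (T : finType) (e : rel T) :
  symmetric e -> irreflexive e ->
  (forall r, let C := component e r in (#|arcs e C| < 2 * #|C|)%N ->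
     (forall x, x \in C -> (degree e x <= 2)%N) /\ (6 <= #|C|)%N) ->
  2 * Num.sqrt (#|T|%:R - 1) <= GA1 R e.
Proof.
move=> e_sym e_irr sparse.
have compE r x : roots e r -> (fingraph.root e x == r) = (x \in component e r).
  move=> rr; rewrite inE (sym_connect_sym e_sym) -(root_connect (sym_connect_sym e_sym)).
  by rewrite (eqP rr).
rewrite GA1_arcs // -sum1_card.
rewrite (partition_big (fingraph.root e) (roots e)) /=; last by move=> x _; apply: roots_root (sym_connect_sym e_sym) x.
rewrite [X in _ <= _ * X](partition_big (fingraph.root e) (roots e)) /=; last by move=> x _; apply: roots_root (sym_connect_sym e_sym) x.
rewrite mulr_sumr; apply: sqrt_sum_le => r rr; rewrite (eq_bigl _ _ (fun x => compE r x rr)).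
  rewrite sum1_card; case: (ltnP #|arcs e (component e r)| (2 * #|component e r|)).
    by case/sparse=> _; apply: leq_trans.
  rewrite card_arcs => dense.
  (* A component with a single vertex has no arcs, since degrees are below [#|C|], and so cannot be
     dense. *)
  rewrite leqNgt; apply/negP => C1.
  have C0 : (0 < #|component e r|)%N by apply/card_gt0P; exists r; apply: component_refl.
  move: dense; rewrite big1; first by rewrite leqNgt muln_gt0 C0.
  move=> x xC; apply/eqP; rewrite -leqn0 -ltnS; apply: leq_trans (degree_component e_irr xC) _.
  exact: C1.
rewrite sum1_card (eq_bigl _ _ (fun x => compE r x rr)).
case: (ltnP #|arcs e (component e r)| (2 * #|component e r|)) => [/sparse[]|].
  exact: GA1_component_sparse.
exact: GA1_component_dense.
Qed.

Theorem theorem3p12 (R : rcfType) (T : finType) (e : rel T) (m : nat)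
  (He : simple_graph e)
  (Hnt : nontrivial_graph e)
  (Hm : #|edges e| = m)
  (Hpath : forall (x : T) (n : nat), (n <= 6)%N ->
     ~ graph_iso (induced e (component e x)) (path_graph n)) :
  2 * Num.sqrt (m%:R - 1) <= GA1 R (line_graph e).
Proof.
have [e_sym e_irr] := He; rewrite -Hm -(card_sig (mem (edges e))).
apply: GA1_ge; [exact: line_graph_sym | exact: line_graph_irr|].
by move=> A; apply: line_graph_component.
Qed.
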